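(* For every real Banach space $X$ with $\dim X\ge 2$ and every $\lambda\in[0,1]$, $$J_\lambda^\perp(X)=\sup\{J_\lambda^\perp(E): E\subset X \text{ a linear subspace},\ \dim E=2\},$$ where each $E$ carries the norm inherited from $X$.
   Context: For a real Banach space $X$, $S_X=\{x\in X:\|x\|=1\}$. For $x,y\in X$, $x\perp_B y$ (Birkhoff--James orthogonality) means $\|x\|\le\|x+ty\|$ for every $t\in\mathbb R$. For $\lambda\in[0,1]$, $$J_\lambda^\perp(X)=\sup\{\min\{\|\lambda x+(1-\lambda)y\|,\|\lambda x-(1-\lambda)y\|\}: x,y\in S_X,\ x\perp_B y\}.$$ *)

(* Defs.v *)
From HB Require Import structures.
From mathcomp Require Import all_boot all_order all_algebra.
From mathcomp Require Import all_classical all_reals all_analysis.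
Set Implicit Arguments.
Unset Strict Implicit.
Unset Printing Implicit Defensive.
Import Order.TTheory GRing.Theory Num.Theory.
Import numFieldNormedType.Exports.
Local Open Scope classical_set_scope.
Local Open Scope ring_scope.

(* The vector spaces below may be infinite-dimensional, so the finite dimension
   of vector.v is not available for them. *)
Section Dimension.
Variables (R : realType) (V : lmodType R).

Definition lin_indep (n : nat) (v : 'I_n -> V) : Prop :=
  forall c : 'I_n -> R, \sum_(i < n) c i *: v i = 0 -> forall i, c i = 0.

Definition spanning (n : nat) (v : 'I_n -> V) : Prop :=
  forall x : V, exists c : 'I_n -> R, x = \sum_(i < n) c i *: v i.

Definition dim_ge (n : nat) : Prop := exists v : 'I_n -> V, lin_indep v.

Definition dim_eq (n : nat) : Prop :=
  exists v : 'I_n -> V, lin_indep v /\ spanning v.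

End Dimension.

Section LinearSubspace.
Variables (R : realType) (X : normedModType R).

(* [submodClosed X] bundles a subset of [X] (a boolean predicate, hence
   classically an arbitrary subset) with its closure under the linear
   operations; [lsubspace E] is the corresponding normed space. *)
Definition lsubspace (E : submodClosed X) : Type := {x : X | x \in E}.

Variable E : submodClosed X.

HB.instance Definition _ := [isSub of lsubspace E for @sval X _].
HB.instance Definition _ := [Choice of lsubspace E by <:].
HB.instance Definition _ := [SubChoice_isSubLmodule of lsubspace E by <:].

Let lsub_norm (x : lsubspace E) : R := `|val x|.

Let lsub_normD x y : lsub_norm (x + y) <= lsub_norm x + lsub_norm y.
Proof. by rewrite /lsub_norm raddfD ler_normD. Qed.

Let lsub_normZ (a : R) x : lsub_norm (a *: x) = `|a| * lsub_norm x.
Proof. by rewrite /lsub_norm linearZ normrZ. Qed.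

Let lsub_norm_eq0 x : lsub_norm x = 0 -> x = 0.
Proof. by move=> /normr0_eq0 x0; apply: val_inj; rewrite x0 raddf0. Qed.

HB.instance Definition _ :=
  Lmodule_isNormed.Build R (lsubspace E) lsub_normD lsub_normZ lsub_norm_eq0.

Lemma lsubspace_normE (x : lsubspace E) : `|x| = `|val x|.
Proof. by []. Qed.

End LinearSubspace.

Definition birkhoff_orth (R : realType) (X : normedModType R) (x y : X) : Prop :=
  forall t : R, `|x| <= `|x + t *: y|.

(* When dim X >= 2 this set is nonempty, and it is bounded by 1 when
   0 <= lambda <= 1, so [sup] is then the genuine supremum. *)
Definition Jperp (R : realType) (lambda : R) (X : normedModType R) : R :=
  sup [set r | exists x y : X,
    [/\ `|x| = 1, `|y| = 1, birkhoff_orth x y &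
        r = Num.min `|lambda *: x + (1 - lambda) *: y|
                    `|lambda *: x - (1 - lambda) *: y| ] ].

(* Main.v *)
Require Import Defs.
From HB Require Import structures.
From mathcomp Require Import all_boot all_order all_algebra.
From mathcomp Require Import all_classical all_reals all_analysis.
Import Order.TTheory GRing.Theory Num.Theory.
Import numFieldNormedType.Exports.
Local Open Scope classical_set_scope.
Local Open Scope ring_scope.

(** The constant only looks at two vectors at a time. Norms, and with them
    Birkhoff-James orthogonality, are the same in a subspace E as in X, so
    every value competing in the supremum for E also competes in the one for
    X; this gives [Jperp_lsubspace_le]. Conversely a value competing in X
    comes from unit vectors x, y with x orthogonal to y. Such vectors are
    linearly independent, so their span is two-dimensional
    ([dim_plane]) and the same value competes in the supremum for that span.

    The real supremum is 0 on the empty set by convention. The sets here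
    consist of nonnegative numbers, so this value is consistent with the
    inequalities between suprema, which therefore require no case distinction
    beyond [sup_le_ubound] and [sup_nneg]. *)

Lemma sup_le_ubound {R : realType} {A : set R} {M : R} :
  0 <= M -> ubound A M -> sup A <= M.
Proof.
move=> M0 AM; have [->|A0] := eqVneq A set0; first by rewrite sup0.
by apply: ge_sup => //; apply/set0P.
Qed.

Lemma sup_nneg {R : realType} {A : set R} :
  (forall r, A r -> 0 <= r) -> 0 <= sup A.
Proof.
move=> A_ge0; have [supA|/sup_out-> //] := pselect (has_sup A).
have [[r Ar] _] := supA.
by apply: (le_trans (A_ge0 r Ar)); apply: sup_upper_bound.
Qed.

(** [Jperp lambda X] is the supremum of this set by conversion. *)
Definition Jperp_values {R : realType} (lambda : R) (X : normedModType R) :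
    set R :=
  [set r | exists x y : X,
    [/\ `|x| = 1, `|y| = 1, birkhoff_orth x y &
        r = Num.min `|lambda *: x + (1 - lambda) *: y|
                    `|lambda *: x - (1 - lambda) *: y| ] ].

Section JperpValues.
Variables (R : realType) (lambda : R) (X : normedModType R).

Lemma Jperp_ge0 : 0 <= Jperp lambda X.
Proof.
by apply: sup_nneg => _ [x [y [_ _ _ ->]]]; rewrite le_min !normr_ge0.
Qed.

Lemma Jperp_values_le1 :
  0 <= lambda <= 1 -> ubound (Jperp_values lambda X) 1.
Proof.
move=> /andP[l0 l1] _ [x [y [x1 y1 _ ->]]]; rewrite ge_min; apply/orP; left.
apply: le_trans (ler_normD _ _) _; rewrite !normrZ x1 y1 !mulr1.
by rewrite !ger0_norm ?subr_ge0// addrC subrK.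
Qed.

Lemma Jperp_upper_bound r :
  0 <= lambda <= 1 -> Jperp_values lambda X r -> r <= Jperp lambda X.
Proof.
move=> hl; apply: (ub_le_sup (E := Jperp_values lambda X)).
by exists 1; exact: Jperp_values_le1.
Qed.

End JperpValues.

Lemma Jperp_lsubspace_le {R : realType} {X : normedModType R} {lambda : R}
    (E : submodClosed X) :
  0 <= lambda <= 1 -> Jperp lambda (lsubspace E) <= Jperp lambda X.
Proof.
move=> hl; apply: sup_le_ubound; first exact: Jperp_ge0.
move=> _ [x [y [x1 y1 xy ->]]]; apply: Jperp_upper_bound => //.
by exists (val x), (val y).
Qed.

Section Plane.
Context {R : realType} {X : normedModType R}.
Implicit Types x y z : X.

Definition plane x y : {pred X} :=
  fun z => `[< exists a b : R, z = a *: x + b *: y >].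

Lemma planeP x y z :
  reflect (exists a b : R, z = a *: x + b *: y) (z \in plane x y).
Proof. exact: asboolP. Qed.

Lemma plane_submod_closed x y : submod_closed (plane x y).
Proof.
split; first by apply/planeP; exists 0, 0; rewrite !scale0r addr0.
move=> c _ _ /planeP[a [b ->]] /planeP[a' [b' ->]].
apply/planeP; exists (c * a + a'), (c * b + b').
by rewrite scalerDr !scalerA !scalerDl addrACA.
Qed.

HB.instance Definition _ x y :=
  GRing.isSubmodClosed.Build R X (plane x y) (plane_submod_closed x y).

Definition plane_space x y : submodClosed X := plane x y.

Lemma plane_memL x y : x \in plane_space x y.
Proof. by apply/planeP; exists 1, 0; rewrite scale1r scale0r addr0. Qed.

Lemma plane_memR x y : y \in plane_space x y.
Proof. by apply/planeP; exists 0, 1; rewrite scale1r scale0r add0r. Qed.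

(** If a were nonzero, then x + (b / a) y = 0, and orthogonality of x to y
    would bound the norm of x by the norm of this zero vector. *)
Lemma birkhoff_orth_free x y (a b : R) :
  x != 0 -> y != 0 -> birkhoff_orth x y -> a *: x + b *: y = 0 ->
  a = 0 /\ b = 0.
Proof.
move=> x0 y0 xy ab0.
have a0 : a = 0.
  apply/eqP; apply: contraNT x0 => a0; rewrite -normr_le0.
  have := xy (a^-1 * b); rewrite -scalerA -{2}[x](scalerK a0) -scalerDr ab0.
  by rewrite scaler0 normr0.
split=> //; apply/eqP; move/eqP: ab0.
by rewrite a0 scale0r add0r scaler_eq0 (negPf y0) orbF.
Qed.

Lemma dim_plane x y :
  x != 0 -> y != 0 -> birkhoff_orth x y ->
  dim_eq (lsubspace (plane_space x y)) 2.
Proof.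
move=> x0 y0 xy.
pose x' : lsubspace (plane_space x y) := exist _ x (plane_memL x y).
pose y' : lsubspace (plane_space x y) := exist _ y (plane_memR x y).
exists (fun i : 'I_2 => if i == ord0 then x' else y'); split.
  move=> c; rewrite big_ord_recl big_ord1 /= => /(congr1 val) c0.
  have [ca cb] := birkhoff_orth_free _ _ _ _ x0 y0 xy c0.
  case=> [[|[|//]] i2].
    by rewrite -ca; congr c; apply: val_inj.
  by rewrite -cb; congr c; apply: val_inj.
move=> [z zP]; have /planeP[a [b zE]] := zP.
exists (fun i => if i == ord0 then a else b).
by rewrite big_ord_recl big_ord1 /=; apply: val_inj.
Qed.

Lemma Jperp_values_plane (lambda : R) x y :
  `|x| = 1 -> `|y| = 1 -> birkhoff_orth x y ->
  Jperp_values lambda (lsubspace (plane_space x y))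
    (Num.min `|lambda *: x + (1 - lambda) *: y|
             `|lambda *: x - (1 - lambda) *: y|).
Proof.
move=> x1 y1 xy.
by exists (exist _ x (plane_memL x y)), (exist _ y (plane_memR x y)).
Qed.

End Plane.

Theorem proposition2p5 (R : realType) (X : completeNormedModType R)
    (lambda : R) (hdim : dim_ge X 2) (hlambda : 0 <= lambda <= 1) :
  Jperp lambda X =
  sup [set Jperp lambda (lsubspace E : normedModType R) |
         E in [set E : submodClosed X | dim_eq (lsubspace E) 2]].
Proof.
set F := [set _ | E in _].
have F_ub : ubound F (Jperp lambda X).
  by move=> _ [E _ <-]; exact: Jperp_lsubspace_le.
apply/eqP; rewrite eq_le; apply/andP; split; last first.
  by apply: sup_le_ubound => //; exact: Jperp_ge0.
apply: sup_le_ubound.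
  by apply: sup_nneg => _ [E _ <-]; exact: Jperp_ge0.
move=> _ [x [y [x1 y1 xy ->]]].
have nz (z : X) : `|z| = 1 -> z != 0.
  by rewrite -normr_eq0 => ->; exact: oner_neq0.
apply: (@le_trans _ _ (Jperp lambda (lsubspace (plane_space x y)))).
  by apply: Jperp_upper_bound => //; exact: Jperp_values_plane.
apply: ub_le_sup; first by exists (Jperp lambda X).
by exists (plane_space x y) => //; apply: dim_plane => //; exact: nz.
Qed.
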